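(* Let $A\to B$ be a map of simplicial commutative rings which is surjective on $\pi_0$. Then the canonical map $$\alpha:(\pi_0R^{\mathrm{ext}}_{B/A})^{\mathrm{reg}}\to \mathrm{cl}R^{\mathrm{ext}}_{\pi_0B/\pi_0A}$$ to the classical extended Rees algebra of $\pi_0A\to\pi_0B$ is an equivalence.
   Context: Rings are simplicial commutative rings and everything is $\infty$-categorical. $\mathrm{Alg}_A$ is the $\infty$-category of $A$-algebras and $\mathrm{Alg}^{\mathbb{Z}}_{A[t^{-1}]}$ that of $\mathbb{Z}$-graded (simplicial commutative) $A[t^{-1}]$-algebras, where $A$ is in degree $0$ and $\deg t^{-1}=-1$. For $Q\in\mathrm{Alg}^{\mathbb{Z}}_{A[t^{-1}]}$, $Q/(t^{-1})=Q\otimes_{A[t^{-1}]}A$ (derived, along $t^{-1}\mapsto0$). For a surjection $A\to B$, the (derived) extended Rees algebra $R^{\mathrm{ext}}_{B/A}\in\mathrm{Alg}^{\mathbb{Z}}_{A[t^{-1}]}$ is the object corepresenting the functor $Q\mapsto\mathrm{Alg}_A(B,(Q/(t^{-1}))_0)$, i.e. there are natural equivalences $\mathrm{Alg}^{\mathbb{Z}}_{A[t^{-1}]}(R^{\mathrm{ext}}_{B/A},Q)\simeq\mathrm{Alg}_A(B,(Q/(t^{-1}))_0)$. (It exists; it is constructed as the graded algebra of functions on $\mathbb{A}^1_X\times_{[\mathbb{A}^1_X/\mathbb{G}_{m,X}]}\mathrm{Res}_{\zeta}([\operatorname{Spec}B/\mathbb{G}_{m,X}])$ for $X=\operatorname{Spec}A$,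 with $\mathrm{Res}_\zeta$ the Weil restriction along the map $\zeta:B\mathbb{G}_{m,X}\to[\mathbb{A}^1_X/\mathbb{G}_{m,X}]$ given by the zero section.) For a discrete ring $k$ and a discrete $\mathbb{Z}$-graded $k[t^{-1}]$-algebra $Q$, call $Q$ $t^{-1}$-regular if $t^{-1}$ is a non-zero-divisor in $Q$. $(-)^{\mathrm{reg}}$ is the left adjoint of the inclusion of $t^{-1}$-regular discrete $\mathbb{Z}$-graded $k[t^{-1}]$-algebras into all discrete $\mathbb{Z}$-graded $k[t^{-1}]$-algebras; explicitly $Q^{\mathrm{reg}}$ is the image of $Q\to Q[(t^{-1})^{-1}]$. Here $k=\pi_0A$. With $I=\ker(\pi_0A\to\pi_0B)$, $\mathrm{cl}R^{\mathrm{ext}}_{\pi_0B/\pi_0A}=\bigoplus_{n\in\mathbb{Z}}I^nt^n\subset\pi_0A[t^{\pm1}]$ ($I^{n}=\pi_0A$ for $n\le0$). It is $t^{-1}$-regular and its quotient by $t^{-1}$ is $\pi_0B$ in degree $0$; the resulting map $B\to(\mathrm{cl}R^{\mathrm{ext}}_{\pi_0B/\pi_0A}/(t^{-1}))_0$ corresponds, via the universal properties of $R^{\mathrm{ext}}_{B/A}$, $\pi_0$ and $(-)^{\mathrm{reg}}$, to the map $\alpha$. *)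

(* Defs.v *)
From HB Require Import structures.
From mathcomp Require Import all_boot all_order all_algebra.
From mathcomp Require Import generic_quotient ring_quotient.
From mathcomp Require Import boolp.

Set Implicit Arguments.
Unset Strict Implicit.
Unset Printing Implicit Defensive.
Import Order.TTheory GRing.Theory Num.Theory.
Local Open Scope ring_scope.
Local Open Scope quotient_scope.

Record dmap (m n : nat) := DMap {
  dfun :> 'I_m.+1 -> 'I_n.+1;
  dmono : forall i j : 'I_m.+1, (i <= j)%N -> (dfun i <= dfun j)%N }.

Lemma dmap_ext m n (s t : dmap m n) : (forall i, s i = t i) -> s = t.
Proof.
case: s t => [s hs] [t ht] /= st; have E : s = t by apply: funext.
by subst t; congr DMap; apply: Prop_irrelevance.
Qed.

Definition did n : dmap n n := @DMap n n id (fun _ _ h => h).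

Definition dcomp m n p (s : dmap n p) (t : dmap m n) : dmap m p :=
  @DMap m p (fun i => s (t i)) (fun _ _ h => dmono s (dmono t h)).

Lemma dcompA m n p q (s : dmap p q) (t : dmap n p) (r : dmap m n) :
  dcomp s (dcomp t r) = dcomp (dcomp s t) r.
Proof. exact: dmap_ext. Qed.

Lemma dcomp_id m n (s : dmap m n) : dcomp s (did m) = s.
Proof. exact: dmap_ext. Qed.

Lemma did_comp m n (s : dmap m n) : dcomp (did n) s = s.
Proof. exact: dmap_ext. Qed.

Definition nonsurj m n (s : dmap m n) : Prop := exists j, forall i, s i <> j.

Lemma nonsurj_comp k m n (s : dmap m n) (t : dmap k m) :
  nonsurj s -> nonsurj (dcomp s t).
Proof. by case=> j hj; exists j => i; apply: hj. Qed.

Lemma coface_mono n (i : 'I_n.+2) (j k : 'I_n.+1) :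
  (j <= k)%N -> (lift i j <= lift i k)%N.
Proof. by rewrite leq_bump2. Qed.

Definition coface n (i : 'I_n.+2) : dmap n n.+1 := DMap (@coface_mono n i).

Definition dconst m n (v : 'I_n.+1) : dmap m n :=
  @DMap m n (fun=> v) (fun _ _ _ => leqnn v).

Record sset := SSet {
  ss_ob :> nat -> Type;
  ss_map : forall m n, dmap m n -> ss_ob n -> ss_ob m;
  ss_id : forall n (x : ss_ob n), ss_map (did n) x = x;
  ss_comp : forall m n p (s : dmap n p) (t : dmap m n) (x : ss_ob p),
    ss_map (dcomp s t) x = ss_map t (ss_map s x) }.

Record smap (X Y : sset) := SMap {
  sm_fun :> forall n, X n -> Y n;
  sm_nat : forall m n (s : dmap m n) (x : X n),
    sm_fun (ss_map s x) = ss_map s (sm_fun x) }.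

Definition spt (X : sset) (x : X 0%N) n : X n := ss_map (dconst n ord0) x.

Definition spherical (X : sset) (x : X 0%N) n (a : X n.+1) : Prop :=
  forall i : 'I_n.+2, ss_map (coface i) a = spt x n.

Definition path0 (X : sset) (a b : X 0%N) : Prop :=
  exists w : X 1%N,
    ss_map (coface ord0) w = a /\ ss_map (coface ord_max) w = b.

(* Homotopy relative to the boundary of two n.+1-simplices that are spherical
   at x: faces 0, ..., n of the homotopy w are constant at x, the last two
   are a and b. *)
Definition htpy (X : sset) (x : X 0%N) n (a b : X n.+1) : Prop :=
  exists w : X n.+2, forall i : 'I_n.+3,
    ss_map (coface i) w =
      if (i < n.+1)%N then spt x n.+1
      else if (i == n.+1 :> nat) then a else b.

(* Bijectivity on pi_0 and on pi_n (n > 0) at all base points, the homotopy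
   groups being the combinatorial ones of a Kan complex.  Below it is applied
   only to simplicial groups and to mapping spaces out of cofibrant objects,
   and these are Kan complexes. *)
Definition is_weq (X Y : sset) (f : smap X Y) : Prop :=
  [/\ forall a b : X 0%N, path0 (f _ a) (f _ b) -> path0 a b,
      forall b : Y 0%N, exists a : X 0%N, path0 (f _ a) b,
      forall (x : X 0%N) n (a b : X n.+1), spherical x a -> spherical x b ->
        htpy (f _ x) (f _ a) (f _ b) -> htpy x a b
    & forall (x : X 0%N) n (b : Y n.+1), spherical (f _ x) b ->
        exists2 a : X n.+1, spherical x a & htpy (f _ x) (f _ a) b].

(* Right lifting property against the inclusions of the boundaries of the
   standard simplices; a map from the boundary of the n-simplex to X is a
   compatible family indexed by the non-surjective maps into [n]. *)
Definition is_tfib (X Y : sset) (f : smap X Y) : Prop :=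
  forall n (y : Y n) (x : forall m (s : dmap m n), nonsurj s -> X m),
    (forall k m (t : dmap k m) (s : dmap m n) (hs : nonsurj s),
       ss_map t (x m s hs) = x k (dcomp s t) (nonsurj_comp t hs)) ->
    (forall m (s : dmap m n) (hs : nonsurj s),
       f _ (x m s hs) = ss_map s y) ->
    exists z : X n, f _ z = y /\
      forall m (s : dmap m n) (hs : nonsurj s), ss_map s z = x m s hs.

Section MkZmodClosed.
Variables (V : zmodType) (P : V -> Prop).
Hypotheses (P0 : P 0) (PB : forall x y, P x -> P y -> P (x - y)).
Let S : pred V := fun x => `[< P x >].
Let S_closed : zmod_closed S.
Proof.
split; first exact: (introT (asboolP _)).
move=> x y; rewrite !unfold_in /S /= => hx hy.
by apply: (introT (asboolP _)); apply: PB; apply: (elimT (asboolP _)).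
Qed.
Definition mk_zmodClosed : zmodClosed V :=
  HB.pack_for (zmodClosed V) S (GRing.isZmodClosed.Build V S S_closed).
Lemma mk_zmodClosedP x : reflect (P x) (x \in mk_zmodClosed).
Proof. exact: (asboolP (P x)). Qed.
End MkZmodClosed.

Lemma quotP (V : zmodType) (I : zmodClosed V) (x y : V) :
  (\pi_(Quotient.quot I) x = \pi_(Quotient.quot I) y) <-> (x - y \in I).
Proof. by rewrite Quotient.idealrBE; split => [->|/eqP]. Qed.

(* Ideals need not be proper and rings may be zero, which is why the ring
   quotients of ring_quotient, restricted to nontrivial rings, do not apply. *)
Record ideal (k : comPzRingType) := Ideal {
  idl :> zmodClosed k;
  idlM : forall a x : k, x \in idl -> a * x \in idl }.

Section RQuot.
Variables (k : comPzRingType) (J : ideal k).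

Definition rquot : Type := Quotient.quot J.
HB.instance Definition _ := GRing.Zmodule.on rquot.

Definition rpi (x : k) : rquot := \pi_(Quotient.quot J) x.
Definition rrepr (x : rquot) : k := repr (x : Quotient.quot J).

Lemma rreprK x : rpi (rrepr x) = x. Proof. exact: reprK. Qed.
Lemma rpiP x y : rpi x = rpi y <-> x - y \in idl J. Proof. exact: quotP. Qed.
Lemma rpiB : {morph rpi : x y / x - y}.
Proof. exact: (raddfB \pi_(Quotient.quot J)). Qed.
Lemma rpiD : {morph rpi : x y / x + y}.
Proof. exact: (raddfD \pi_(Quotient.quot J)). Qed.

Definition rquot_mul (x y : rquot) : rquot := rpi (rrepr x * rrepr y).

Lemma rpiM x y : rpi (x * y) = rquot_mul (rpi x) (rpi y).
Proof.
apply/rpiP.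
have hx : x - rrepr (rpi x) \in idl J by apply/rpiP; rewrite rreprK.
have hy : y - rrepr (rpi y) \in idl J by apply/rpiP; rewrite rreprK.
rewrite -[_ * _](addrNK (x * rrepr (rpi y))) -mulrBr -addrA -mulrBl.
by apply: rpredD; [exact: idlM | rewrite mulrC; exact: idlM].
Qed.

Let mulA : associative rquot_mul.
Proof.
by move=> x y z; rewrite -(rreprK x) -(rreprK y) -(rreprK z) -!rpiM mulrA.
Qed.
Let mulC : commutative rquot_mul.
Proof. by move=> x y; rewrite -(rreprK x) -(rreprK y) -!rpiM mulrC. Qed.
Let mul1 : left_id (rpi 1) rquot_mul.
Proof. by move=> x; rewrite -(rreprK x) -!rpiM mul1r. Qed.
Let mulD : left_distributive rquot_mul +%R.
Proof.
move=> x y z; rewrite -(rreprK x) -(rreprK y) -(rreprK z).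
by rewrite -rpiD -!rpiM mulrDl rpiD.
Qed.

HB.instance Definition _ :=
  GRing.Zmodule_isComPzRing.Build rquot mulA mulC mul1 mulD.

HB.instance Definition _ := GRing.isZmodMorphism.Build k rquot rpi rpiB.
HB.instance Definition _ :=
  GRing.isMonoidMorphism.Build k rquot rpi (erefl, rpiM).

End RQuot.

Section RLift.
Variables (k l : comPzRingType) (J : ideal k) (f : {rmorphism k -> l}).
Hypothesis fJ : forall x, x \in idl J -> f x = 0.

Definition rlift_fun (x : rquot J) : l := f (rrepr x).

Lemma rlift_pi x : rlift_fun (rpi J x) = f x.
Proof.
apply/eqP; rewrite -subr_eq0 -rmorphB; apply/eqP/fJ/rpiP.
by rewrite rreprK.
Qed.

Let liftB : {morph rlift_fun : x y / x - y}.
Proof.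
by move=> x y; rewrite -(rreprK x) -(rreprK y) -rmorphB !rlift_pi rmorphB.
Qed.
Let liftM : monoid_morphism rlift_fun.
Proof.
split; first by rewrite -(rmorph1 (rpi J)) rlift_pi rmorph1.
by move=> x y; rewrite -(rreprK x) -(rreprK y) -rmorphM !rlift_pi rmorphM.
Qed.
HB.instance Definition _ := GRing.isZmodMorphism.Build _ _ rlift_fun liftB.
HB.instance Definition _ := GRing.isMonoidMorphism.Build _ _ rlift_fun liftM.

Definition rlift : {rmorphism rquot J -> l} := rlift_fun.
Lemma rliftE x : rlift (rpi J x) = f x.
Proof. exact: rlift_pi. Qed.
End RLift.

Section Kernel.
Variables (k l : comPzRingType) (f : {rmorphism k -> l}).
Let ker0 : f 0 = 0. Proof. exact: rmorph0. Qed.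
Let kerB x y : f x = 0 -> f y = 0 -> f (x - y) = 0.
Proof. by rewrite rmorphB => -> ->; rewrite subr0. Qed.
Let kerM (a x : k) : x \in mk_zmodClosed ker0 kerB ->
  a * x \in mk_zmodClosed ker0 kerB.
Proof.
by move=> /mk_zmodClosedP h; apply/mk_zmodClosedP; rewrite rmorphM h mulr0.
Qed.
Definition kernel : ideal k := Ideal kerM.
End Kernel.

(* A graded ring is given by its homogeneous components.  The product of
   elements of degrees i and j lands in any degree n provably equal to i + j,
   which avoids transport along equalities of degrees. *)
Record gring := MkGRing {
  gr_ob :> int -> zmodType;
  gr_mul : forall i j n, i + j = n -> gr_ob i -> gr_ob j -> gr_ob n;
  gr_one : gr_ob 0;
  gr_mulDl : forall i j n (h : i + j = n) x y z,
    gr_mul h (x + y) z = gr_mul h x z + gr_mul h y z;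
  gr_mulC : forall i j n (h : i + j = n) (h' : j + i = n) x y,
    gr_mul h x y = gr_mul h' y x;
  gr_mulA : forall i j k ij jk n (h1 : i + j = ij) (h2 : ij + k = n)
      (h3 : j + k = jk) (h4 : i + jk = n) x y z,
    gr_mul h4 x (gr_mul h3 y z) = gr_mul h2 (gr_mul h1 x y) z;
  gr_mul1 : forall i (h : 0 + i = i) x, gr_mul h gr_one x = x }.

Lemma gr_mulDr (X : gring) i j n (h : i + j = n) (x : X i) (y z : X j) :
  gr_mul h x (y + z) = gr_mul h x y + gr_mul h x z.
Proof.
have h' : j + i = n by rewrite addrC.
by rewrite !(gr_mulC h h') gr_mulDl.
Qed.

Lemma gr_mulBr (X : gring) i j n (h : i + j = n) (x : X i) (y z : X j) :
  gr_mul h x (y - z) = gr_mul h x y - gr_mul h x z.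
Proof. by apply/eqP; rewrite eq_sym subr_eq -gr_mulDr subrK. Qed.

Lemma gr_mulBl (X : gring) i j n (h : i + j = n) (x y : X i) (z : X j) :
  gr_mul h (x - y) z = gr_mul h x z - gr_mul h y z.
Proof. by apply/eqP; rewrite eq_sym subr_eq -gr_mulDl subrK. Qed.

Lemma gr_mul0r (X : gring) i j n (h : i + j = n) (x : X i) :
  gr_mul h x (0 : X j) = 0.
Proof. by rewrite -(subrr 0) gr_mulBr subrr. Qed.

Record ghom (X Y : gring) := GHom {
  gh_fun :> forall i, {additive X i -> Y i};
  gh_mul : forall i j n (h : i + j = n) x y,
    gh_fun n (gr_mul h x y) = gr_mul h (gh_fun i x) (gh_fun j y);
  gh_one : gh_fun 0 (gr_one X) = gr_one Y }.

Section Deg0.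
Variable X : gring.
Definition deg0 : Type := X 0.
HB.instance Definition _ := GRing.Zmodule.on deg0.
Definition deg0_mul (x y : deg0) : deg0 := gr_mul (addr0 0) x y.
Let mulA : associative deg0_mul.
Proof. by move=> x y z; apply: gr_mulA. Qed.
Let mulC : commutative deg0_mul.
Proof. by move=> x y; apply: gr_mulC. Qed.
Let mul1 : left_id (gr_one X : deg0) deg0_mul.
Proof. by move=> x; apply: gr_mul1. Qed.
Let mulD : left_distributive deg0_mul +%R.
Proof. by move=> x y z; apply: gr_mulDl. Qed.
HB.instance Definition _ :=
  GRing.Zmodule_isComPzRing.Build deg0 mulA mulC mul1 mulD.
End Deg0.

Section Deg0Map.
Variables (X Y : gring) (f : ghom X Y).
Definition deg0_fun (x : deg0 X) : deg0 Y := f 0 x.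
Let fB : {morph deg0_fun : x y / x - y}.
Proof. exact: (raddfB (f 0)). Qed.
Let fM : monoid_morphism deg0_fun.
Proof. by split; [apply: gh_one | move=> x y; apply: gh_mul]. Qed.
HB.instance Definition _ := GRing.isZmodMorphism.Build _ _ deg0_fun fB.
HB.instance Definition _ := GRing.isMonoidMorphism.Build _ _ deg0_fun fM.
Definition deg0_map : {rmorphism deg0 X -> deg0 Y} := deg0_fun.
End Deg0Map.

Record gideal (X : gring) := GIdeal {
  gidl :> forall n, zmodClosed (X n);
  gidlM : forall i j n (h : i + j = n) (a : X i) (x : X j),
    x \in gidl j -> gr_mul h a x \in gidl n }.

Section GQuot.
Variables (X : gring) (J : gideal X).

Definition gquot_ob (n : int) : zmodType := Quotient.quot (J n).
Definition gpi n (x : X n) : gquot_ob n := \pi_(Quotient.quot (J n)) x.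
Definition grepr n (x : gquot_ob n) : X n := repr (x : Quotient.quot (J n)).

Lemma greprK n (x : gquot_ob n) : gpi (grepr x) = x.
Proof. exact: reprK. Qed.
Lemma gpiP n (x y : X n) : gpi x = gpi y <-> x - y \in J n.
Proof. exact: quotP. Qed.
Lemma gpiB n : {morph @gpi n : x y / x - y}.
Proof. exact: (raddfB \pi_(Quotient.quot (J n))). Qed.
Lemma gpiD n : {morph @gpi n : x y / x + y}.
Proof. exact: (raddfD \pi_(Quotient.quot (J n))). Qed.

Definition gquot_mul i j n (h : i + j = n) (x : gquot_ob i) (y : gquot_ob j) :
  gquot_ob n := gpi (gr_mul h (grepr x) (grepr y)).

Lemma gpiM i j n (h : i + j = n) (x : X i) (y : X j) :
  gpi (gr_mul h x y) = gquot_mul h (gpi x) (gpi y).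
Proof.
apply/gpiP; have h' : j + i = n by rewrite addrC.
have hx : x - grepr (gpi x) \in J i by apply/gpiP; rewrite greprK.
have hy : y - grepr (gpi y) \in J j by apply/gpiP; rewrite greprK.
rewrite -[gr_mul h x y](addrNK (gr_mul h x (grepr (gpi y)))).
rewrite -gr_mulBr -addrA -gr_mulBl.
by apply: rpredD; [exact: gidlM | rewrite (gr_mulC h h'); exact: gidlM].
Qed.

Definition gquot : gring.
Proof.
refine (@MkGRing gquot_ob gquot_mul (gpi (gr_one X)) _ _ _ _).
- move=> i j n h x y z; rewrite -(greprK x) -(greprK y) -(greprK z).
  by rewrite -gpiD -!gpiM gr_mulDl gpiD.
- move=> i j n h h' x y; rewrite -(greprK x) -(greprK y) -!gpiM.
  by rewrite (gr_mulC h h').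
- move=> i j k ij jk n h1 h2 h3 h4 x y z.
  rewrite -(greprK x) -(greprK y) -(greprK z) -!gpiM.
  by rewrite (gr_mulA h1 h2 h3 h4).
- by move=> i h x; rewrite -(greprK x) -gpiM gr_mul1.
Defined.

HB.instance Definition _ n :=
  GRing.isZmodMorphism.Build (X n) (gquot_ob n) (@gpi n) (@gpiB n).

Definition gproj : ghom X gquot :=
  @GHom X gquot (fun n => @gpi n) gpiM erefl.
End GQuot.

Section GLift.
Variables (X Y : gring) (J : gideal X) (f : ghom X Y).
Hypothesis fJ : forall n (x : X n), x \in J n -> f n x = 0.

Definition glift_fun n (x : gquot J n) : Y n := f n (@grepr X J n x).

Lemma glift_pi n (x : X n) : glift_fun (@gpi X J n x) = f n x.
Proof.
apply/eqP; rewrite -subr_eq0 -raddfB; apply/eqP/fJ.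
by apply/(@gpiP X J n); rewrite greprK.
Qed.

Let liftB n : {morph @glift_fun n : x y / x - y}.
Proof.
move=> x y; rewrite -[x](@greprK X J n) -[y](@greprK X J n).
by rewrite -gpiB !glift_pi raddfB.
Qed.
HB.instance Definition _ n :=
  GRing.isZmodMorphism.Build (gquot J n) (Y n) (@glift_fun n) (@liftB n).

Definition glift : ghom (gquot J) Y.
Proof.
refine (@GHom (gquot J) Y (fun n => @glift_fun n) _ _).
- move=> i j n h x y; rewrite -[x](@greprK X J i) -[y](@greprK X J j) /=.
  by rewrite -gpiM !glift_pi gh_mul.
- by rewrite [LHS]glift_pi gh_one.
Defined.
End GLift.

Definition ghom_comp (X Y Z : gring) (g : ghom Y Z) (f : ghom X Y) : ghom X Z.
Proof.
refine (@GHom X Z (fun i => (g i \o f i : X i -> Z i)) _ _).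
- by move=> i j n h x y /=; rewrite !gh_mul.
- by rewrite /= !gh_one.
Defined.

Record trng := TRng { tr_gr :> gring; tinv : tr_gr (-1) }.

Record thom (X Y : trng) := THom {
  th_gh :> ghom X Y;
  th_t : th_gh (-1) (tinv X) = tinv Y }.

Definition thom_comp (X Y Z : trng) (g : thom Y Z) (f : thom X Y) : thom X Z.
Proof.
by refine (@THom X Z (ghom_comp g f) _); rewrite /= !th_t.
Defined.

Definition tmul (X : trng) (n : int) (y : X (1 + n)) : X n :=
  gr_mul (addKr 1 n) (tinv X) y.

Definition t_regular (X : trng) : Prop :=
  forall n, injective (@tmul X n).

Section TIdeal.
Variable X : trng.
Let P n (x : X n) : Prop := exists y : X (1 + n), x = tmul y.
Let P0 n : @P n 0.
Proof. by exists 0; rewrite /tmul gr_mul0r. Qed.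
Let PB n (x y : X n) : P x -> P y -> P (x - y).
Proof. by move=> [a ->] [b ->]; exists (a - b); rewrite /tmul gr_mulBr. Qed.
Let PM i j n (h : i + j = n) (a : X i) (x : X j) :
  x \in mk_zmodClosed (@P0 j) (@PB j) ->
  gr_mul h a x \in mk_zmodClosed (@P0 n) (@PB n).
Proof.
move=> /mk_zmodClosedP [y ->]; apply/mk_zmodClosedP.
have h1 : i + (1 + j) = 1 + n by rewrite addrCA h.
exists (gr_mul h1 a y); rewrite /tmul.
have e1 : i + -1 = -1 + i by rewrite addrC.
have e2 : -1 + i + (1 + j) = n by rewrite -h addrACA addNr add0r.
rewrite (gr_mulA e1 e2 _ _) (gr_mulC e1 erefl).
by rewrite -(gr_mulA erefl e2 h1 (addKr 1 n)).
Qed.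
Definition tideal : gideal X := GIdeal PM.

Lemma tidealP n (x : X n) :
  reflect (exists y : X (1 + n), x = tmul y) (x \in tideal n).
Proof. exact: mk_zmodClosedP. Qed.
End TIdeal.

Definition tquot (X : trng) : gring := gquot (tideal X).

Section TQuotMap.
Variables (X Y : trng) (f : thom X Y).
Lemma tquot_map_kernel n (x : X n) :
  x \in tideal X n -> ghom_comp (gproj (tideal Y)) f n x = 0.
Proof.
move=> /tidealP [y ->] /=; rewrite -(raddf0 (gproj (tideal Y) n)) /=.
apply/(@gpiP Y (tideal Y) n); rewrite subr0; apply/tidealP.
by exists (f _ y); rewrite /tmul gh_mul th_t.
Qed.
Definition tquot_map : ghom (tquot X) (tquot Y) := glift tquot_map_kernel.
End TQuotMap.

Lemma tquot_map_pi (X Y : trng) (f : thom X Y) n (x : X n) :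
  tquot_map f n (gproj (tideal X) n x) = gproj (tideal Y) n (f n x).
Proof. exact: (glift_pi (@tquot_map_kernel X Y f)). Qed.

Definition tquot0 (X : trng) : comPzRingType := deg0 (tquot X).
Definition tquot0_map (X Y : trng) (f : thom X Y) :
  {rmorphism tquot0 X -> tquot0 Y} := deg0_map (tquot_map f).
Definition tquot0_pi (X : trng) : {rmorphism deg0 X -> tquot0 X} :=
  deg0_map (gproj (tideal X)).

(* A discrete graded k[t^-1]-algebra: the structure map k[t^-1] -> Q is given
   by its degree-0 part k -> Q_0 and by the image of t^-1 in Q_(-1). *)
Record galg (k : comPzRingType) := GAlg {
  ga_rng :> trng;
  ga_str : {rmorphism k -> deg0 ga_rng} }.

Record galg_hom (k : comPzRingType) (X Y : galg k) := GAlgHom {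
  gah :> thom X Y;
  gah_str : forall a : k, gah 0 (ga_str X a) = ga_str Y a }.

(* eta : Q -> S is the unit at Q of the left adjoint (-)^reg. *)
Definition is_regularization (k : comPzRingType) (Q S : galg k)
    (eta : galg_hom Q S) : Prop :=
  t_regular S /\
  forall T : galg k, t_regular T -> forall g : galg_hom Q T,
    (exists h : galg_hom S T, forall n x, h n (eta n x) = g n x) /\
    (forall h h' : galg_hom S T,
       (forall n x, h n (eta n x) = g n x) ->
       (forall n x, h' n (eta n x) = g n x) ->
       forall n x, h n x = h' n x).

Record scring := SCRing {
  sr_ob :> nat -> comPzRingType;
  sr_map : forall m n, dmap m n -> {rmorphism sr_ob n -> sr_ob m};
  sr_id : forall n (x : sr_ob n), sr_map (did n) x = x;
  sr_comp : forall m n p (s : dmap n p) (t : dmap m n) (x : sr_ob p),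
    sr_map (dcomp s t) x = sr_map t (sr_map s x) }.

Arguments sr_map {_ m n} _.

Definition sset_of_scring (A : scring) : sset :=
  @SSet (fun n => A n) (fun m n s => sr_map s) (@sr_id A) (@sr_comp A).

Record scring_hom (A B : scring) := SCRingHom {
  srh :> forall n, {rmorphism A n -> B n};
  srh_nat : forall m n (s : dmap m n) (x : A n),
    srh m (sr_map s x) = sr_map s (srh n x) }.

Definition smap_of_scring_hom (A B : scring) (f : scring_hom A B) :
    smap (sset_of_scring A) (sset_of_scring B) :=
  @SMap (sset_of_scring A) (sset_of_scring B) (fun n => f n) (@srh_nat A B f).

Record calg (A : scring) := CAlg {
  ca_ring :> scring;
  ca_str : scring_hom A ca_ring }.

Record calg_hom (A : scring) (B C : calg A) := CAlgHom {
  cah :> scring_hom B C;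
  cah_str : forall n (a : A n), cah n (ca_str B n a) = ca_str C n a }.

(* Quillen's model structure on simplicial commutative A-algebras: weak
   equivalences and fibrations are those of the underlying simplicial sets. *)
Definition calg_cofibrant (A : scring) (B : calg A) : Prop :=
  forall (C D : calg A) (p : calg_hom C D) (g : calg_hom B D),
    is_tfib (smap_of_scring_hom p) ->
    exists h : calg_hom B C, forall n x, p n (h n x) = g n x.

(* The mapping space Alg_A(B, C) for cofibrant B (every C is fibrant): an
   n-simplex is a simplicial A-algebra map from B to the cotensor of C by the
   standard n-simplex, that is, a family of ring maps B_m -> C_m indexed by
   the m-simplices s : [m] -> [n] and natural in m. *)
Section CMap.
Variables (A : scring) (B C : calg A).

Record cmap_ob (n : nat) := CMapOb {
  cm_fun :> forall m, dmap m n -> {rmorphism B m -> C m};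
  cm_nat : forall l m (t : dmap l m) (s : dmap m n) (x : B m),
    cm_fun (dcomp s t) (sr_map t x) = sr_map t (cm_fun s x);
  cm_str : forall m (s : dmap m n) (a : A m),
    cm_fun s (ca_str B m a) = ca_str C m a }.

Lemma cmap_ext n (f g : cmap_ob n) :
  (forall m (s : dmap m n), f m s = g m s) -> f = g.
Proof.
case: f g => [f f1 f2] [g g1 g2] /= fg.
have E : f = g by apply: functional_extensionality_dep => m; apply: funext.
by subst g; congr CMapOb; apply: Prop_irrelevance.
Qed.

Definition cmap_act m n (r : dmap m n) (f : cmap_ob n) : cmap_ob m.
Proof.
refine (@CMapOb m (fun l (s : dmap l m) => f l (dcomp r s)) _ _).
- by move=> l p t s x; rewrite dcompA cm_nat.
- by move=> p s a; rewrite cm_str.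
Defined.

Definition cmap : sset.
Proof.
refine (@SSet cmap_ob cmap_act _ _).
- by move=> n f; apply: cmap_ext => m s /=; rewrite did_comp.
- by move=> m n p r q f; apply: cmap_ext => l s /=; rewrite dcompA.
Defined.
End CMap.

Record strng := STRng {
  st_ob :> nat -> trng;
  st_map : forall m n, dmap m n -> thom (st_ob n) (st_ob m);
  st_id : forall n i (x : st_ob n i), st_map (did n) i x = x;
  st_comp : forall m n p (s : dmap n p) (t : dmap m n) i (x : st_ob p i),
    st_map (dcomp s t) i x = st_map t i (st_map s i x) }.

(* A simplicial graded A[t^-1]-algebra, with A in degree 0; as for galg, the
   structure map A[t^-1] -> Q is given by A -> Q_0 and the (levelwise,
   compatible) elements t^-1 of Q_(-1). *)
Record salg (A : scring) := SAlg {
  sa_rng :> strng;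
  sa_str : forall m, {rmorphism A m -> deg0 (sa_rng m)};
  sa_nat : forall m n (s : dmap m n) (a : A n),
    sa_str m (sr_map s a) = st_map sa_rng s 0 (sa_str n a) }.

Record salg_hom (A : scring) (P Q : salg A) := SAlgHom {
  sah :> forall m, thom (P m) (Q m);
  sah_nat : forall m n (s : dmap m n) i (x : P n i),
    sah m i (st_map P s i x) = st_map Q s i (sah n i x);
  sah_str : forall m (a : A m), sah m 0 (sa_str P m a) = sa_str Q m a }.

Definition sset_of_strng (Q : strng) (i : int) : sset :=
  @SSet (fun n => Q n i) (fun m n s => st_map Q s i)
    (fun n => @st_id Q n i) (fun m n p s t => @st_comp Q m n p s t i).

Definition smap_of_salg_hom (A : scring) (P Q : salg A) (f : salg_hom P Q)
    (i : int) : smap (sset_of_strng P i) (sset_of_strng Q i) :=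
  @SMap (sset_of_strng P i) (sset_of_strng Q i) (fun n => f n i)
    (fun m n s => @sah_nat A P Q f m n s i).

(* Weak equivalences and fibrations of graded algebras are those of the
   underlying simplicial sets of all the homogeneous components. *)
Definition salg_weq (A : scring) (P Q : salg A) (f : salg_hom P Q) : Prop :=
  forall i, is_weq (smap_of_salg_hom f i).

Definition salg_cofibrant (A : scring) (R : salg A) : Prop :=
  forall (C D : salg A) (p : salg_hom C D) (g : salg_hom R D),
    (forall i, is_tfib (smap_of_salg_hom p i)) ->
    exists h : salg_hom R C, forall n i x, p n i (h n i x) = g n i x.

Section GMap.
Variables (A : scring) (R Q : salg A).

Record gmap_ob (n : nat) := GMapOb {
  gm_fun :> forall m, dmap m n -> thom (R m) (Q m);
  gm_nat : forall l m (t : dmap l m) (s : dmap m n) i (x : R m i),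
    gm_fun (dcomp s t) i (st_map R t i x) = st_map Q t i (gm_fun s i x);
  gm_str : forall m (s : dmap m n) (a : A m),
    gm_fun s 0 (sa_str R m a) = sa_str Q m a }.

Lemma gmap_ext n (f g : gmap_ob n) :
  (forall m (s : dmap m n), f m s = g m s) -> f = g.
Proof.
case: f g => [f f1 f2] [g g1 g2] /= fg.
have E : f = g by apply: functional_extensionality_dep => m; apply: funext.
by subst g; congr GMapOb; apply: Prop_irrelevance.
Qed.

Definition gmap_act m n (r : dmap m n) (f : gmap_ob n) : gmap_ob m.
Proof.
refine (@GMapOb m (fun l (s : dmap l m) => f l (dcomp r s)) _ _).
- by move=> l p t s i x; rewrite dcompA gm_nat.
- by move=> p s a; rewrite gm_str.
Defined.

Definition gmap : sset.
Proof.
refine (@SSet gmap_ob gmap_act _ _).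
- by move=> n f; apply: gmap_ext => m s /=; rewrite did_comp.
- by move=> m n p r q f; apply: gmap_ext => l s /=; rewrite dcompA.
Defined.
End GMap.


Section GPost.
Variables (A : scring) (R P Q : salg A) (p : salg_hom P Q).

Definition gpost_fun n (f : gmap R P n) : gmap R Q n.
Proof.
refine (@GMapOb A R Q n (fun m s => thom_comp (p m) (gm_fun f s)) _ _).
- by move=> l m t s i x /=; rewrite gm_nat sah_nat.
- by move=> m s a /=; rewrite gm_str sah_str.
Defined.

Definition gpost : smap (gmap R P) (gmap R Q).
Proof.
by refine (@SMap (gmap R P) (gmap R Q) gpost_fun _) => m n s f; apply: gmap_ext.
Defined.
End GPost.

Lemma tquot0_map_pi (X Y : trng) (f : thom X Y) (x : deg0 X) :
  tquot0_map f (tquot0_pi X x) = tquot0_pi Y (deg0_map f x).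
Proof. exact: tquot_map_pi. Qed.

Lemma tquot0_piK (X : trng) (x : tquot0 X) : exists y, x = tquot0_pi X y.
Proof. by exists (@grepr X (tideal X) 0 x); rewrite -[LHS](@greprK X (tideal X) 0). Qed.

Section TQuotAlg.
Variables (A : scring) (Q : salg A).

Definition tquot0_scring : scring.
Proof.
refine (@SCRing (fun n => tquot0 (Q n))
          (fun m n s => tquot0_map (st_map Q s)) _ _).
- move=> n x; have [y ->] := tquot0_piK x.
  by rewrite tquot0_map_pi; congr (tquot0_pi _ _); apply: st_id.
- move=> m n p s t x; have [y ->] := tquot0_piK x.
  by rewrite !tquot0_map_pi; congr (tquot0_pi _ _); apply: st_comp.
Defined.

(* Levelwise quotient by t^-1.  When t^-1 is a non-zero-divisor in every Q_m,
   one has Tor_i(Q_m, A_m) = 0 over A_m[t^-1] for all i > 0, so that this is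
   the degree-0 part of the derived tensor product of Q and A over A[t^-1]. *)
Definition tquot0_alg : calg A.
Proof.
refine (@CAlg A tquot0_scring
  (@SCRingHom A tquot0_scring (fun n => tquot0_pi (Q n) \o sa_str Q n) _)).
by move=> m n s a /=; rewrite sa_nat tquot0_map_pi.
Defined.
End TQuotAlg.

Definition levelwise_t_regular (A : scring) (Q : salg A) : Prop :=
  forall m, t_regular (Q m).

Section Univ.
Variables (A : scring) (B : calg A) (R : salg A).
Variable u : calg_hom B (tquot0_alg R).

Definition univ_fun (Q : salg A) n (f : gmap R Q n) :
  cmap B (tquot0_alg Q) n.
Proof.
refine (@CMapOb A B (tquot0_alg Q) n
  (fun m s => tquot0_map (gm_fun f s) \o u m) _ _).
- move=> l m t s x /=; rewrite srh_nat /=.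
  have [y ->] := tquot0_piK (u m x).
  by rewrite !tquot0_map_pi; congr (tquot0_pi _ _); apply: gm_nat.
- move=> m s a; rewrite [LHS]/=.
  rewrite (cah_str u) /= tquot0_map_pi.
  by congr (tquot0_pi _ _); apply: gm_str.
Defined.

Definition univ (Q : salg A) : smap (gmap R Q) (cmap B (tquot0_alg Q)).
Proof.
by refine (@SMap (gmap R Q) (cmap B (tquot0_alg Q)) (@univ_fun Q) _)
  => m n s f; apply: cmap_ext.
Defined.
End Univ.

(* R^ext_(B/A): a cofibrant R together with a universal point u of
   Alg_A(B, (R/(t^-1))_0), for B cofibrant over A; u is an actual map because
   R, being cofibrant, is levelwise t^-1-regular.  At an arbitrary Q the
   derived quotient is computed on a levelwise t^-1-regular resolution
   p : P -> Q, and the equivalence of mapping spaces is the zigzag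
   Map(R, Q) <- Map(R, P) -> Alg_A(B, (P/(t^-1))_0). *)
Definition is_extended_rees (A : scring) (B : calg A) (R : salg A)
    (u : calg_hom B (tquot0_alg R)) : Prop :=
  salg_cofibrant R /\
  forall (Q P : salg A) (p : salg_hom P Q),
    salg_weq p -> levelwise_t_regular P ->
    is_weq (gpost R p) /\ is_weq (univ u P).

Lemma dcomp_dconst l m n (s : dmap m n) (v : 'I_m.+1) :
  dcomp s (dconst l v) = dconst l (s v).
Proof. exact: dmap_ext. Qed.

Lemma edge_mono n (v : 'I_n.+1) (i j : 'I_2) : (i <= j)%N ->
  ((if i == ord0 then ord0 else v : 'I_n.+1) <=
    (if j == ord0 then ord0 else v : 'I_n.+1))%N.
Proof. by case: i j => [[|[|i]] hi] [[|[|j]] hj]. Qed.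
Definition edge n (v : 'I_n.+1) : dmap 1 n := DMap (@edge_mono n v).

Lemma edge_coface0 n (v : 'I_n.+1) : dcomp (edge v) (coface ord0) = dconst 0 v.
Proof. by apply: dmap_ext => i; rewrite ord1. Qed.
Lemma edge_coface1 n (v : 'I_n.+1) :
  dcomp (edge v) (coface ord_max) = dconst 0 ord0.
Proof. by apply: dmap_ext => i; rewrite ord1. Qed.
Lemma dconst_coface n (i : 'I_n.+2) :
  dcomp (dconst n.+1 ord0) (coface i) = dconst n (ord0 : 'I_1).
Proof. exact: dmap_ext. Qed.
Lemma dconst_did : dconst 0 ord0 = did 0.
Proof. by apply: dmap_ext => i /=; rewrite [RHS]ord1. Qed.

Section Pi0.
Variable A : scring.
Let P (x : A 0%N) : Prop := exists y : A 1%N,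
  x = sr_map (coface ord0) y - sr_map (coface ord_max) y.
Let P0 : P 0.
Proof. by exists 0; rewrite !rmorph0 subrr. Qed.
Let PB x y : P x -> P y -> P (x - y).
Proof.
by move=> [a ->] [b ->]; exists (a - b);
  rewrite !rmorphB [in LHS]opprD [LHS]addrACA -opprD.
Qed.
Let PM (a x : A 0%N) :
  x \in mk_zmodClosed P0 PB -> a * x \in mk_zmodClosed P0 PB.
Proof.
move=> /mk_zmodClosedP [y ->]; apply/mk_zmodClosedP.
exists (sr_map (dconst 1 ord0) a * y).
by rewrite !rmorphM -!sr_comp !dconst_coface dconst_did !sr_id mulrBr.
Qed.
Definition pi0_ideal : ideal (A 0%N) := Ideal PM.
Lemma pi0_idealP x : reflect (P x) (x \in idl pi0_ideal).
Proof. exact: mk_zmodClosedP. Qed.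

Definition pi0 : comPzRingType := rquot pi0_ideal.

(* The unit A -> pi_0 A, in level n: the class of the 0-th vertex. *)
Definition to_pi0 n : {rmorphism A n -> pi0} :=
  rpi pi0_ideal \o sr_map (dconst 0 ord0).

Lemma to_pi0_nat m n (s : dmap m n) (a : A n) :
  to_pi0 m (sr_map s a) = to_pi0 n a.
Proof.
rewrite /= -sr_comp dcomp_dconst; apply/rpiP/pi0_idealP.
by exists (sr_map (edge (s ord0)) a); rewrite -!sr_comp edge_coface0 edge_coface1.
Qed.
End Pi0.

Section Pi0Map.
Variables (A B : scring) (f : scring_hom A B).
Lemma pi0_map_kernel x : x \in idl (pi0_ideal A) -> (to_pi0 B 0 \o f 0%N) x = 0.
Proof.
move=> /pi0_idealP [y ->]; rewrite rmorphB /= !srh_nat.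
by apply/eqP; rewrite subr_eq0; apply/eqP; rewrite [LHS](to_pi0_nat (coface ord0))
  [RHS](to_pi0_nat (coface ord_max)).
Qed.
Definition pi0_map : {rmorphism pi0 A -> pi0 B} := rlift pi0_map_kernel.
End Pi0Map.

Section GPi0.
Variable Q : strng.
Let P i (x : Q 0%N i) : Prop := exists y : Q 1%N i,
  x = st_map Q (coface ord0) i y - st_map Q (coface ord_max) i y.
Let P0 i : @P i 0.
Proof. by exists 0; rewrite !raddf0 addr0. Qed.
Let PB i (x y : Q 0%N i) : P x -> P y -> P (x - y).
Proof.
by move=> [a ->] [b ->]; exists (a - b);
  rewrite (raddfB (st_map Q (coface ord0) i)) (raddfB (st_map Q (coface ord_max) i))
    [in LHS]opprD [LHS]addrACA -opprD.
Qed.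
Let PM i j n (h : i + j = n) (a : Q 0%N i) (x : Q 0%N j) :
  x \in mk_zmodClosed (@P0 j) (@PB j) ->
  gr_mul h a x \in mk_zmodClosed (@P0 n) (@PB n).
Proof.
move=> /mk_zmodClosedP [y ->]; apply/mk_zmodClosedP.
exists (gr_mul h (st_map Q (dconst 1 ord0) i a) y).
by rewrite !gh_mul -!st_comp !dconst_coface dconst_did !st_id gr_mulBr.
Qed.
Definition gpi0_gideal : gideal (Q 0%N) := GIdeal PM.
Lemma gpi0_gidealP i (x : Q 0%N i) : reflect (P x) (x \in gpi0_gideal i).
Proof. exact: mk_zmodClosedP. Qed.

Definition gpi0_trng : trng :=
  @TRng (gquot gpi0_gideal) (gproj gpi0_gideal (-1) (tinv (Q 0%N))).

Definition gproj0 : thom (Q 0%N) gpi0_trng :=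
  @THom (Q 0%N) gpi0_trng (gproj gpi0_gideal) erefl.

Definition to_gpi0 n : thom (Q n) gpi0_trng :=
  thom_comp gproj0 (st_map Q (dconst 0 ord0)).

Lemma to_gpi0_nat m n (s : dmap m n) i (a : Q n i) :
  to_gpi0 m i (st_map Q s i a) = to_gpi0 n i a.
Proof.
rewrite /= -st_comp dcomp_dconst; apply/(@gpiP _ gpi0_gideal)/gpi0_gidealP.
by exists (st_map Q (edge (s ord0)) i a); rewrite -!st_comp edge_coface0 edge_coface1.
Qed.
End GPi0.

Section Pi0Alg.
Variables (A : scring) (Q : salg A).
Lemma gpi0_str_kernel x : x \in idl (pi0_ideal A) ->
  (deg0_map (to_gpi0 Q 0) \o sa_str Q 0) x = 0.
Proof.
move=> /pi0_idealP [y ->]; rewrite rmorphB /= !sa_nat.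
by apply/eqP; rewrite subr_eq0; apply/eqP; rewrite [LHS](to_gpi0_nat (coface ord0))
  [RHS](to_gpi0_nat (coface ord_max)).
Qed.
Definition gpi0 : galg (pi0 A) := @GAlg (pi0 A) (gpi0_trng Q) (rlift gpi0_str_kernel).
End Pi0Alg.

Definition thom_id (X : trng) : thom X X :=
  @THom X X (@GHom X X (fun i => idfun : {additive X i -> X i})
    (fun _ _ _ _ _ _ => erefl) erefl) erefl.

Definition const_strng (X : trng) : strng :=
  @STRng (fun=> X) (fun _ _ _ => thom_id X) (fun _ _ _ => erefl)
    (fun _ _ _ _ _ _ _ => erefl).

Definition const_salg (A : scring) (C : galg (pi0 A)) : salg A.
Proof.
refine (@SAlg A (const_strng C) (fun m => ga_str C \o to_pi0 A m) _).
by move=> m n s a; congr (ga_str C _); apply: to_pi0_nat.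
Defined.

(* The map R -> pi_0 R -> C with discrete target determined by g. *)
Definition pi0_adj (A : scring) (R : salg A) (C : galg (pi0 A))
  (g : galg_hom (gpi0 R) C) : salg_hom R (const_salg C).
Proof.
refine (@SAlgHom A R (const_salg C) (fun m => thom_comp g (to_gpi0 R m)) _ _).
- by move=> m n s i x; congr (g i _); apply: to_gpi0_nat.
- move=> m a; rewrite [RHS]/= -(gah_str g) [LHS]/=; congr (g 0 _).
  rewrite [RHS](rliftE (@gpi0_str_kernel A R)) /= !sa_nat.
  exact/esym/(to_gpi0_nat (dconst 0 ord0)).
Defined.

Section Subz.
Variables (V : zmodType) (S : zmodClosed V).
Record subz := Subz { subz_val :> V; subzP : subz_val \in S }.
HB.instance Definition _ := [isSub for subz_val].
HB.instance Definition _ := [Choice of subz by <:].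
HB.instance Definition _ := [SubChoice_isSubZmodule of subz by <:].
End Subz.

Section IdealPower.
Variables (k : comPzRingType) (I : ideal k).

(* I * J: finite sums of products a * b with a in I and b in J. *)
Inductive imul (J : k -> Prop) : k -> Prop :=
| imul_nil : imul J 0
| imul_cons a b x : a \in idl I -> J b -> imul J x -> imul J (a * b + x).

Fixpoint ipow (n : nat) : k -> Prop :=
  if n is n'.+1 then imul (ipow n') else fun=> True.

Definition ipowz (n : int) : k -> Prop :=
  if n is Posz n' then ipow n' else fun=> True.

Lemma imulD (J : k -> Prop) x y : imul J x -> imul J y -> imul J (x + y).
Proof.
by elim=> [|a b z ha hb hz IH] hy; rewrite ?add0r // -addrA;
  apply: imul_cons => //; apply: IH.
Qed.

Lemma imulN (J : k -> Prop) x : imul J x -> imul J (- x).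
Proof.
elim=> [|a b z ha hb hz IH]; first by rewrite oppr0; apply: imul_nil.
by rewrite opprD -mulNr; apply: imul_cons; rewrite ?rpredN.
Qed.

Lemma imulM (J : k -> Prop) c x : imul J x -> imul J (c * x).
Proof.
elim=> [|a b z ha hb hz IH]; first by rewrite mulr0; apply: imul_nil.
by rewrite mulrDr mulrA; apply: imul_cons => //; apply: idlM.
Qed.

Lemma ipow0 n : ipow n 0.
Proof. by case: n => [|n] //; apply: imul_nil. Qed.

Lemma ipowB n x y : ipow n x -> ipow n y -> ipow n (x - y).
Proof. by case: n => [|n] // hx hy; apply: imulD => //; apply: imulN. Qed.

Lemma ipowM n c x : ipow n x -> ipow n (c * x).
Proof. by case: n => [|n] //; apply: imulM. Qed.

Lemma ipowS n x : ipow n.+1 x -> ipow n x.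
Proof.
elim=> [|a b z _ hb _ hz]; first exact: ipow0.
by rewrite -[z]opprK; apply: ipowB; [apply: ipowM | rewrite -sub0r;
  apply: ipowB => //; apply: ipow0].
Qed.

Lemma ipow_le m n x : (m <= n)%N -> ipow n x -> ipow m x.
Proof.
move=> /subnKC <-; elim: (n - m)%N => [|d IH]; first by rewrite addn0.
by rewrite addnS => /ipowS.
Qed.

Lemma ipowD m n x y : ipow m x -> ipow n y -> ipow (m + n) (x * y).
Proof.
elim: m x => [|m IH] x hx hy; first exact: ipowM.
elim: hx => [|a b z ha hb _ hz]; first by rewrite mul0r; apply: ipow0.
by rewrite mulrDl -mulrA addSn; apply: imul_cons => //; apply: IH.
Qed.

Lemma ipowz0 n : ipowz n 0.
Proof. by case: n => // n; apply: ipow0. Qed.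

Lemma ipowzB n x y : ipowz n x -> ipowz n y -> ipowz n (x - y).
Proof. by case: n => // n; apply: ipowB. Qed.

Lemma ipowzD i j n x y : i + j = n -> ipowz i x -> ipowz j y ->
  ipowz n (x * y).
Proof.
move=> <- {n}; case: i j => [i|i] [j|j] hx hy.
- exact: ipowD.
- move: hx; case E : (Posz i + Negz j) => [n|n] // hx.
  rewrite mulrC; apply/ipowM/(ipow_le _ hx); rewrite -lez_nat -E.
  by rewrite gerDl.
- case E : (Negz i + Posz j) => [n|n] //.
  apply/ipowM/(ipow_le _ hy); rewrite -lez_nat -E.
  by rewrite gerDr.
- by case E : (Negz i + Negz j).
Qed.

Definition ipowz_closed n : zmodClosed k :=
  mk_zmodClosed (ipowz0 n) (@ipowzB n).

Lemma ipowz_closedP n x : reflect (ipowz n x) (x \in ipowz_closed n).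
Proof. exact: mk_zmodClosedP. Qed.

(* The component in degree n is I^n t^n, identified with I^n in k; the product
   is the one of k[t, t^-1]. *)
Definition rees_mul i j n (h : i + j = n) (x : subz (ipowz_closed i))
    (y : subz (ipowz_closed j)) : subz (ipowz_closed n) :=
  Subz (introT (ipowz_closedP n _)
    (ipowzD h (elimT (ipowz_closedP i _) (subzP x))
              (elimT (ipowz_closedP j _) (subzP y)))).

Definition rees_cst n (c : k) (h : ipowz n c) : subz (ipowz_closed n) :=
  Subz (introT (ipowz_closedP n c) h).

Definition rees_gring : gring.
Proof.
refine (@MkGRing (fun n => subz (ipowz_closed n)) rees_mul
  (@rees_cst 0 1 Logic.I) _ _ _ _).
- by move=> i j n h x y z; apply: val_inj; rewrite /= mulrDl.
- by move=> i j n h h' x y; apply: val_inj; rewrite /= mulrC.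
- by move=> *; apply: val_inj; rewrite /= mulrA.
- by move=> i h x; apply: val_inj; rewrite /= mul1r.
Defined.

Definition rees_trng : trng := @TRng rees_gring (@rees_cst (-1) 1 Logic.I).

Definition rees_str (c : k) : deg0 rees_trng := @rees_cst 0 c Logic.I.

Let rees_strB : {morph rees_str : x y / x - y}.
Proof. by move=> x y; apply: val_inj. Qed.
Let rees_strM : monoid_morphism rees_str.
Proof. by split=> [|x y]; apply: val_inj. Qed.
HB.instance Definition _ := GRing.isZmodMorphism.Build _ _ rees_str rees_strB.
HB.instance Definition _ := GRing.isMonoidMorphism.Build _ _ rees_str rees_strM.

Definition cl_rees : galg k := @GAlg k rees_trng rees_str.

End IdealPower.

Definition galg_comp (k : comPzRingType) (X Y Z : galg k)
  (g : galg_hom Y Z) (f : galg_hom X Y) : galg_hom X Z.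
Proof.
refine (@GAlgHom k X Z (thom_comp g f) _).
by move=> a /=; rewrite !gah_str.
Defined.

(* The map R -> pi_0 R -> S -> cl R^ext determined by alpha corresponds under u
   to the composite of q : B' -> B with the canonical map
   B -> pi_0 B = (cl R^ext/(t^-1))_0, which sends b to the class of any
   a in pi_0 A lifting the class of b.  All mapping spaces into discrete
   objects are discrete, so the correspondence is an equality of maps. *)
Definition is_alpha (A B : scring) (f : scring_hom A B)
    (B' : calg A) (q : calg_hom B' (CAlg f))
    (R : salg A) (u : calg_hom B' (tquot0_alg R))
    (S : galg (pi0 A)) (eta : galg_hom (gpi0 R) S)
    (alpha : galg_hom S (cl_rees (kernel (pi0_map f)))) : Prop :=
  forall m (b : B' m) (a : pi0 A), pi0_map f a = to_pi0 B m (q m b) ->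
    tquot0_map (pi0_adj (galg_comp alpha eta) m) (u m b) =
    tquot0_pi (cl_rees (kernel (pi0_map f)))
      (ga_str (cl_rees (kernel (pi0_map f))) a).

(* Main.v *)
(* Put k = pi_0 A and I = ker (pi_0 A -> pi_0 B).  For a discrete t^-1-regular
   graded k[t^-1]-algebra C, mapping spaces into C are discrete, so the universal
   properties give Hom ((pi_0 R)^reg, C) = Hom_A (B, (C/(t^-1))_0).  Since
   pi_0 B = k/I, the right-hand side has at most one element, and it has one
   exactly when I maps into t^-1 C_1.  On the other hand, a map cl R^ext -> C must
   send c t^n to the unique y with y = c t^n in C[(t^-1)^-1], and such a y exists
   for all c in I^n exactly when I maps into t^-1 C_1.  So (pi_0 R)^reg and
   cl R^ext corepresent the same functor. *)
Require Import Defs.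
From HB Require Import structures.
From mathcomp Require Import all_boot all_order all_algebra.
From mathcomp Require Import boolp zify.

Set Implicit Arguments.
Unset Strict Implicit.
Unset Printing Implicit Defensive.
Import GRing.Theory.
Local Open Scope ring_scope.

(** * Ring maps and homotopies with discrete target *)

Lemma rmorph_ext (k l : pzRingType) (f g : {rmorphism k -> l}) :
  f =1 g -> f = g.
Proof.
case: f g => [f [[fD] [fM]]] [g [[gD] [gM]]] /= fg.
have E : f = g by apply: funext.
subst g; congr GRing.RMorphism.Pack.
by congr GRing.RMorphism.Class; [congr GRing.isNmodMorphism.Axioms_
  | congr GRing.isMonoidMorphism.Axioms_]; apply: Prop_irrelevance.
Qed.

(** A homotopy into a discrete set is constant: restriction to vertex 0 of x reduces to a vertex,
    and on the degenerate edge there the value at [did 1] equals the values at both ends of the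
    interval. *)
Lemma interval_family_const (X : sset) (D : Type)
    (F : forall m, dmap m 1 -> X m -> D) :
  (forall l m (t : dmap l m) (s : dmap m 1) x,
     F l (dcomp s t) (ss_map t x) = F m s x) ->
  forall m (s s' : dmap m 1) x, F m s x = F m s' x.
Proof.
move=> FE m.
suff vertexE (s : dmap m 1) x : F m s x = F 1%N (did 1) (ss_map (dconst 1 ord0) x).
  by move=> s s' x; rewrite !vertexE.
rewrite -(FE _ _ (dconst 0 ord0)) -(FE _ _ (dconst 0 (s ord0)) (did 1)).
by rewrite -ss_comp !dcomp_dconst.
Qed.

Section SurjFactor.
Variables (k l d : comPzRingType) (f : {rmorphism k -> l}) (g : {rmorphism k -> d}).
Hypothesis f_surj : forall y, exists x, f x = y.
Hypothesis kerfg : forall x, f x = 0 -> g x = 0.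

Definition surj_factor_fun (y : l) : d := g (projT1 (cid (f_surj y))).

Lemma surj_factor_funE x : surj_factor_fun (f x) = g x.
Proof.
rewrite /surj_factor_fun; case: cid => x' /= xx'.
by apply/eqP; rewrite -subr_eq0 -rmorphB kerfg // rmorphB xx' subrr.
Qed.

Let factorB : {morph surj_factor_fun : x y / x - y}.
Proof.
move=> x y; have [[a <-] [b <-]] := (f_surj x, f_surj y).
by rewrite -rmorphB !surj_factor_funE rmorphB.
Qed.
Let factorM : monoid_morphism surj_factor_fun.
Proof.
split=> [|x y]; first by rewrite -(rmorph1 f) surj_factor_funE rmorph1.
have [[a <-] [b <-]] := (f_surj x, f_surj y).
by rewrite -rmorphM !surj_factor_funE rmorphM.
Qed.
HB.instance Definition _ := GRing.isZmodMorphism.Build l d surj_factor_fun factorB.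
HB.instance Definition _ := GRing.isMonoidMorphism.Build l d surj_factor_fun factorM.

Definition surj_factor : {rmorphism l -> d} := surj_factor_fun.
Lemma surj_factorE x : surj_factor (f x) = g x.
Proof. exact: surj_factor_funE. Qed.
End SurjFactor.

(** * Homogeneous elements, powers of t^-1 and the relation y = c t^n *)

(* Pairing homogeneous elements with their degrees turns them into an honest
   commutative monoid, free of transports between degrees. *)
Section Homogeneous.
Variable X : gring.

Definition helt : Type := {n : int & X n}.
Definition hel n (x : X n) : helt := existT _ n x.
Definition hmul (x y : helt) : helt := hel (gr_mul erefl (tagged x) (tagged y)).

Lemma hel_inj n : injective (@hel n).
Proof. by move=> x y /eqP; rewrite eq_Tagged => /eqP. Qed.

Lemma hmulE i j n (h : i + j = n) (x : X i) (y : X j) :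
  hmul (hel x) (hel y) = hel (gr_mul h x y).
Proof. by case: n / h. Qed.

Lemma hmulC : commutative hmul.
Proof.
move=> [i x] [j y]; rewrite (hmulE erefl) (hmulE (addrC j i)).
by congr hel; apply: gr_mulC.
Qed.

Lemma hmulA : associative hmul.
Proof.
move=> [i x] [j y] [l z]; rewrite (hmulE erefl y) (hmulE erefl).
rewrite (hmulE erefl x) (hmulE (esym (addrA i j l))).
by congr hel; apply: gr_mulA.
Qed.

Lemma hmulCA : left_commutative hmul.
Proof. by move=> x y z; rewrite !hmulA (hmulC x). Qed.

Lemma hmulACA : interchange hmul hmul.
Proof. by move=> x y z w; rewrite -!hmulA (hmulCA y). Qed.

Lemma hmul1 x : hmul (hel (gr_one X)) x = x.
Proof. by case: x => i x; rewrite (hmulE (add0r i)) gr_mul1. Qed.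

Lemma hel_add i j (x x' : X i) (y y' : X j) :
  hel x = hel y -> hel x' = hel y' -> hel (x + x') = hel (y + y').
Proof.
move=> xy; have ij : i = j := congr1 (@tag _ _) xy.
by case: j / ij y y' xy => y y' /hel_inj-> /hel_inj->.
Qed.

Lemma hmulD z z' i j (x x' : X i) (y y' : X j) :
  hmul z (hel x) = hmul z' (hel y) -> hmul z (hel x') = hmul z' (hel y') ->
  hmul z (hel (x + x')) = hmul z' (hel (y + y')).
Proof. by case: z z' => [a z] [b z']; rewrite /hmul !gr_mulDr; apply: hel_add. Qed.

End Homogeneous.

Section TPow.
Variable X : trng.

(* A power of t^-1, not of t: tpow n has degree -n. *)
Definition tpow (n : nat) : helt X := iter n (hmul (hel (tinv X))) (hel (gr_one X)).

Lemma tpowD m n : tpow (m + n) = hmul (tpow m) (tpow n).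
Proof.
by elim: m => [|m IH]; rewrite ?hmul1 // addSn /= IH hmulA.
Qed.

Lemma tag_tpow n : tag (tpow n) = - n%:Z.
Proof. by elim: n => //= n ->; rewrite intS opprD. Qed.

Hypothesis Xreg : t_regular X.

Lemma hmul_tinv_inj n (x y : X n) :
  hmul (hel (tinv X)) (hel x) = hmul (hel (tinv X)) (hel y) -> x = y.
Proof.
(* [t_regular] speaks of degrees of the form 1 + m, so n is rewritten as 1 + (n - 1). *)
have := subrKC 1 n; move: (n - 1) => m nE; case: n / nE x y => x y.
by rewrite !(hmulE (addKr 1 m)) => /hel_inj /Xreg.
Qed.

Lemma hmul_tpow_inj p n (x y : X n) :
  hmul (tpow p) (hel x) = hmul (tpow p) (hel y) -> x = y.
Proof.
elim: p => [|p IH]; first by rewrite !hmul1 => /hel_inj.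
rewrite /= -!hmulA => h; apply: IH.
by case: (tpow p) h => a z h; apply: (congr1 (@hel X _)); apply: hmul_tinv_inj.
Qed.

End TPow.

Section ScalarRel.
Variable k : comPzRingType.
Implicit Type C : galg k.

Definition hstr C (c : k) : helt C := @hel C 0 (ga_str C c).

Lemma hstrM C c d : hstr C (c * d) = hmul (hstr C c) (hstr C d).
Proof. by rewrite /hstr rmorphM (hmulE (addr0 0)). Qed.

Lemma hmul_tpow_addl C (x y : helt C) p q r :
  hmul (tpow C p) x = hmul (tpow C q) y ->
  hmul (tpow C (p + r)) x = hmul (tpow C (q + r)) y.
Proof. by move=> e; rewrite !(addnC _ r) !tpowD -!hmulA e. Qed.

(* The relation y = c t^n, which makes sense in the localization at t^-1,
   expressed in C itself by clearing denominators. *)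
Definition scalar_rel C n (c : k) (y : C n) : Prop :=
  exists p q, hmul (tpow C p) (hel y) = hmul (tpow C q) (hstr C c).

(** Comparing degrees gives p - q = n in both relations, so multiplying each by the power of t^-1 on
    the left of the other produces the same pair of exponents. *)
Lemma scalar_rel_common C n c d (y z : C n) :
  scalar_rel c y -> scalar_rel d z -> exists p q,
    hmul (tpow C p) (hel y) = hmul (tpow C q) (hstr C c) /\
    hmul (tpow C p) (hel z) = hmul (tpow C q) (hstr C d).
Proof.
move=> [p [q e]] [p' [q' e']]; exists (p + p')%N, (q + p')%N.
split; first exact: hmul_tpow_addl.
have -> : (q + p' = q' + p)%N.
  have := congr1 (@tag _ _) e; have := congr1 (@tag _ _) e'.
  by rewrite /= !tag_tpow; lia.
by rewrite [(p + p')%N]addnC; apply: hmul_tpow_addl.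
Qed.

Lemma scalar_rel_inj C n c (y y' : C n) : t_regular C ->
  scalar_rel c y -> scalar_rel c y' -> y = y'.
Proof.
move=> Creg yc y'c; have [p [q [e e']]] := scalar_rel_common yc y'c.
by apply: (hmul_tpow_inj Creg (p := p)); rewrite e e'.
Qed.

Lemma scalar_relD C n c d (y z : C n) :
  scalar_rel c y -> scalar_rel d z -> scalar_rel (c + d) (y + z).
Proof.
move=> yc zd; have [p [q [e e']]] := scalar_rel_common yc zd.
by exists p, q; rewrite /hstr rmorphD; apply: hmulD.
Qed.

Lemma scalar_relM C i j n (h : i + j = n) c d (y : C i) (z : C j) :
  scalar_rel c y -> scalar_rel d z -> scalar_rel (c * d) (gr_mul h y z).
Proof.
move=> [p [q e]] [p' [q' e']]; exists (p + p')%N, (q + q')%N.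
by rewrite -hmulE hstrM !tpowD hmulACA e e' hmulACA.
Qed.

Lemma scalar_rel_str C c : scalar_rel c (ga_str C c : C 0).
Proof. by exists 0%N, 0%N. Qed.

Lemma scalar_rel0 C n : scalar_rel 0 (0 : C n).
Proof.
(* The zeros of degrees n and 0 are distinct in [helt]; exponents with p - q = n bring them to the
   same degree. *)
have [p [q pq]] : exists p q : nat, - p%:Z + n = - q%:Z + 0.
  by case: n => n; [exists n, 0%N | exists 0%N, n.+1]; lia.
exists p, q; rewrite /hstr rmorph0.
have := tag_tpow C p; have := tag_tpow C q.
case: (tpow C p) (tpow C q) => [a x] [b y] /= eb ea; subst a b.
by rewrite (hmulE pq) (hmulE erefl) !gr_mul0r.
Qed.

Lemma scalar_rel_tinv C : scalar_rel 1 (tinv C).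
Proof.
by exists 0%N, 1%N; rewrite /hstr rmorph1 /= [in RHS]hmulC [RHS]hmul1 !hmul1 hmulC hmul1.
Qed.

Lemma scalar_rel_one C : scalar_rel 1 (gr_one C).
Proof. by rewrite -[gr_one C](rmorph1 (ga_str C)); apply: scalar_rel_str. Qed.

Section Hom.
Variables (X Y : galg k) (h : galg_hom X Y).
Let hmap (x : helt X) : helt Y := hel (h _ (tagged x)).

Let hmapM x y : hmap (hmul x y) = hmul (hmap x) (hmap y).
Proof. by rewrite /hmap /= gh_mul. Qed.

Let hmap_tpow p : hmap (tpow X p) = tpow Y p.
Proof.
elim: p => [|p IH] /=; first by rewrite /hmap /= gh_one.
by rewrite hmapM IH /hmap /= th_t.
Qed.

Lemma scalar_rel_hom n c (y : X n) : scalar_rel c y -> scalar_rel c (h n y).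
Proof.
move=> [p [q /(congr1 hmap)]]; rewrite !hmapM !hmap_tpow.
by rewrite /hmap /= gah_str => e; exists p, q.
Qed.
End Hom.

End ScalarRel.

(** * Universal property of the classical extended Rees algebra *)

Section ReesUniversal.
Variables (k : comPzRingType) (I : ideal k).

Lemma cl_rees_regular : t_regular (cl_rees I).
Proof.
by move=> n x y /(congr1 val) /=; rewrite !mul1r => /val_inj.
Qed.

(** Setting t = 1 is multiplicative and sends t^-1 to 1, which turns the relation into an equality
    in k. *)
Lemma cl_rees_scalar_rel n c (x : cl_rees I n) : scalar_rel c x -> val x = c.
Proof.
pose hval (x : helt (cl_rees I)) : k := val (tagged x).
have hval_tpow p : hval (tpow (cl_rees I) p) = 1.
  by elim: p => //= p IH; rewrite /hval /= mul1r; apply: IH.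
move=> [p [q /(congr1 hval)]].
by rewrite /hval /= -!/(hval _) !hval_tpow !mul1r.
Qed.

Lemma cl_rees_ideal a : a \in idl I -> ga_str (cl_rees I) a \in tideal (cl_rees I) 0.
Proof.
move=> aI; apply/tidealP.
have a1 : ipowz I 1 a.
  by rewrite -[a]mulr1 -[a * 1]addr0; apply: imul_cons => //; apply: imul_nil.
(* The witness is a t in degree 1. *)
by exists (@rees_cst _ I 1 a a1); apply: val_inj; rewrite /= mul1r.
Qed.

Variable C : galg k.
Hypothesis Creg : t_regular C.
Hypothesis CI : forall a, a \in idl I -> ga_str C a \in tideal C 0.

(** For a in I, writing a = t^-1 w gives w = a t; then a b t^(n+1) is the product of w and b t^n,
    and sums of such products exhaust I^(n+1). *)
Lemma scalar_rel_ex_pos (n : nat) c :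
  ipow I n c -> exists y : C n, scalar_rel c y.
Proof.
elim: n c => [|n IH] c; first by exists (ga_str C c); apply: scalar_rel_str.
elim=> [|a b x aI bn _ [z zx]]; first by exists 0; apply: scalar_rel0.
have [y yb] := IH _ bn; have /tidealP [w aw] := CI aI.
have wa : @scalar_rel k C 1 a w.
  exists 1%N, 0%N; rewrite hmul1 /hstr aw /= [hmul (hel (tinv C)) _]hmulC hmul1.
  by rewrite -(hmulE (addKr 1 0)).
exists (gr_mul (erefl : 1 + n%:Z = n.+1) w y + z).
by apply: scalar_relD => //; apply: scalar_relM.
Qed.

Lemma scalar_rel_ex n c : ipowz I n c -> exists y : C n, scalar_rel c y.
Proof.
case: n => n; first exact: scalar_rel_ex_pos.
(* [Negz n] is -(n+1), so the element sought is c times the power n+1 of t^-1. *)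
move=> _; have [y yE] : exists y : C (Negz n), tpow C n.+1 = hel y.
  have := tag_tpow C n.+1; case: (tpow C n.+1) => a y /= aE.
  by subst a; exists y.
have [z zc] : exists z : C 0, scalar_rel c z.
  by exists (ga_str C c); apply: scalar_rel_str.
exists (gr_mul (addr0 _) y z); rewrite -[c]mul1r; apply: scalar_relM => //.
by exists 0%N, n.+1; rewrite -yE hmul1 /hstr rmorph1 hmulC hmul1.
Qed.

Definition rees_lift_fun n (x : cl_rees I n) : C n :=
  projT1 (cid (scalar_rel_ex (elimT (ipowz_closedP I n _) (subzP x)))).

Lemma rees_lift_funP n (x : cl_rees I n) : scalar_rel (val x) (rees_lift_fun x).
Proof. exact: projT2 (cid _). Qed.

(** Uniqueness in a regular C reduces every morphism law for the lift to closure of [scalar_rel]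
    under the corresponding operation. *)
Lemma rees_lift_funE n (x : cl_rees I n) (y : C n) :
  scalar_rel (val x) y -> rees_lift_fun x = y.
Proof. by move=> xy; apply: scalar_rel_inj xy => //; apply: rees_lift_funP. Qed.

Let liftD n : nmod_morphism (@rees_lift_fun n).
Proof.
split=> [|x y]; apply: rees_lift_funE; first exact: scalar_rel0.
by apply: scalar_relD; apply: rees_lift_funP.
Qed.
HB.instance Definition _ n :=
  GRing.isNmodMorphism.Build (cl_rees I n) (C n) (@rees_lift_fun n) (@liftD n).

Definition rees_lift : galg_hom (cl_rees I) C.
Proof.
unshelve refine (@GAlgHom k (cl_rees I) C
  (@THom (cl_rees I) C (@GHom (cl_rees I) C (fun n => @rees_lift_fun n) _ _) _) _).
- move=> i j n h x y; apply: rees_lift_funE.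
  by apply: scalar_relM; apply: rees_lift_funP.
- by apply: rees_lift_funE; apply: scalar_rel_one.
- by apply: rees_lift_funE; apply: scalar_rel_tinv.
- by move=> a; apply: rees_lift_funE; apply: scalar_rel_str.
Defined.

(** Both maps preserve [scalar_rel], which in the Rees algebra determines the element. *)
Lemma rees_liftK (h : galg_hom C (cl_rees I)) n : cancel (rees_lift n) (h n).
Proof.
move=> x; apply: val_inj; apply: cl_rees_scalar_rel.
by apply: scalar_rel_hom; apply: rees_lift_funP.
Qed.

End ReesUniversal.

(** * Mapping spaces into discrete algebras *)

Section DiscreteTarget.
Variables (A : scring) (C : galg (pi0 A)).
Let const_map m n (s : dmap m n) : thom C C := st_map (const_salg C) s.

Lemma tquot0_const_map m n (s : dmap m n) x :
  @sr_map (tquot0_alg (const_salg C)) m n s x = x.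
Proof.
by have [y ->] := tquot0_piK (X := C) x; rewrite [LHS](tquot0_map_pi (const_map s)).
Qed.

Definition const_salg_id : salg_hom (const_salg C) (const_salg C) :=
  @SAlgHom A (const_salg C) (const_salg C) (fun=> thom_id C)
    (fun _ _ _ _ _ => erefl) (fun _ _ => erefl).

(** For regular C this makes [const_salg C] its own resolution, so [is_extended_rees] applies with P
    = Q. *)
Lemma const_salg_id_weq : salg_weq const_salg_id.
Proof.
move=> i; split=> //= [b|x n b xb]; first by exists b, b.
have {b xb} -> : b = x := xb ord0.
by exists x => //; exists x => j /=; rewrite !if_same.
Qed.

Variables (B : calg A) (R : salg A).

Lemma path0_gmap_const (f g : gmap R (const_salg C) 0%N) :
  path0 f g -> forall m (s : dmap m 0) i x, gm_fun f s i x = gm_fun g s i x.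
Proof.
move=> [w [<- <-]] m s i x /=.
apply: (@interval_family_const (sset_of_strng R i) _ (fun m s x => gm_fun w s i x)).
by move=> l n t r y; exact: (gm_nat w t r y).
Qed.

Lemma path0_cmap_const (f g : cmap B (tquot0_alg (const_salg C)) 0%N) :
  path0 f g -> forall m (s : dmap m 0) x, cm_fun f s x = cm_fun g s x.
Proof.
move=> [w [<- <-]] m s x /=.
apply: (@interval_family_const (sset_of_scring B) (tquot0 C) (fun m s x => cm_fun w s x)).
by move=> l n t r y; rewrite /= cm_nat tquot0_const_map.
Qed.

Section GmapOfHom.
Variable g : galg_hom (gpi0 R) C.
Definition gmap_of_hom : gmap R (const_salg C) 0%N.
Proof.
refine (@GMapOb A R (const_salg C) 0 (fun m _ => pi0_adj g m) _ _).
- by move=> l m t _ i x; apply: (sah_nat (pi0_adj g)).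
- by move=> m _ a; apply: (sah_str (pi0_adj g)).
Defined.
End GmapOfHom.

Section HomOfGmap.
Variable f : gmap R (const_salg C) 0%N.

Lemma gmap_const_kernel i (x : R 0%N i) :
  x \in gpi0_gideal R i -> gm_fun f (did 0) i x = 0.
Proof.
move=> /gpi0_gidealP [y ->]; rewrite raddfB; apply/eqP; rewrite subr_eq0; apply/eqP.
(* As the target is constant, f takes at either end of the edge y its value on y itself. *)
have fE v : gm_fun f (did 0) i (st_map R (coface v) i y) = gm_fun f (dconst 1 ord0) i y.
  have -> : did 0 = dcomp (dconst 1 ord0) (coface v).
    by apply: dmap_ext => j; apply: ord1.
  exact: (gm_nat f (coface v) (dconst 1 ord0) y).
by rewrite !fE.
Qed.

Definition hom_of_gmap : galg_hom (gpi0 R) C.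
Proof.
unshelve refine (@GAlgHom _ (gpi0 R) C (@THom (gpi0 R) C (glift gmap_const_kernel) _) _).
- by rewrite [LHS](glift_pi gmap_const_kernel) th_t.
- move=> a; rewrite -(rreprK a) [X in glift _ _ X](rliftE (@gpi0_str_kernel A R)).
  rewrite [LHS](glift_pi gmap_const_kernel).
  rewrite -sa_nat [LHS](gm_str f); congr (ga_str C _).
  by rewrite to_pi0_nat /= dconst_did sr_id.
Defined.

Lemma pi0_adj_hom_of_gmap m (s : dmap m 0) i (x : R m i) :
  pi0_adj hom_of_gmap m i x = gm_fun f s i x.
Proof.
rewrite [LHS](glift_pi gmap_const_kernel).
have -> : did 0 = dcomp s (dconst 0 ord0) by apply: dmap_ext => j; rewrite ord1 [RHS]ord1.
exact: (gm_nat f (dconst 0 ord0) s x).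
Qed.
End HomOfGmap.

Variable u : calg_hom B (tquot0_alg R).
Hypotheses (u_univ : is_extended_rees u) (C_regular : t_regular C).

Let univ_weq : is_weq (univ u (const_salg C)).
Proof.
have [_ /(_ _ _ const_salg_id const_salg_id_weq)] := u_univ.
by case=> // m; apply: C_regular.
Qed.

(** [univ] is injective on path components, and homotopic maps into a discrete algebra are equal. *)
Lemma gpi0_hom_ext (g g' : galg_hom (gpi0 R) C) :
  (forall m (b : B m),
     tquot0_map (pi0_adj g m) (u m b) = tquot0_map (pi0_adj g' m) (u m b)) ->
  forall n x, g n x = g' n x.
Proof.
move=> gg' n x; have [univ_inj _ _ _] := univ_weq.
have eq_gmap : path0 (gmap_of_hom g) (gmap_of_hom g').
  apply: univ_inj; set v := univ u _ _ _; set v' := univ u _ _ _.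
  have -> : v = v' by apply: cmap_ext => m s; apply: rmorph_ext => b; apply: gg'.
  (* The path is the degenerate edge at v'. *)
  by exists (ss_map (dconst 1 ord0) v'); rewrite -!ss_comp !dconst_coface dconst_did ss_id.
rewrite -[x](@greprK _ (gpi0_gideal R)).
have := path0_gmap_const eq_gmap (did 0) (@grepr _ (gpi0_gideal R) n x).
by rewrite /= dconst_did !st_id.
Qed.

Lemma gpi0_hom_ex (phi : cmap B (tquot0_alg (const_salg C)) 0%N) :
  exists g : galg_hom (gpi0 R) C, forall m (s : dmap m 0) (b : B m),
    tquot0_map (pi0_adj g m) (u m b) = cm_fun phi s b.
Proof.
have [_ /(_ phi) [f /path0_cmap_const fphi] _ _] := univ_weq.
exists (hom_of_gmap f) => m s b; rewrite -fphi /=.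
have [y ->] := tquot0_piK (u m b); rewrite !tquot0_map_pi.
by congr (tquot0_pi _ _); apply: pi0_adj_hom_of_gmap.
Qed.
End DiscreteTarget.

(** * Rigidity of maps out of B and the comparison map *)

Lemma path0_of_to_pi0 (A : scring) (x y : sset_of_scring A 0%N) :
  to_pi0 A 0 x = to_pi0 A 0 y -> path0 x y.
Proof.
rewrite /= dconst_did !sr_id => /rpiP /pi0_idealP [z xy].
(* Translating z by a degenerate edge moves its last face to y, and hence its first face to x. *)
exists (z + sr_map (dconst 1 ord0) (y - sr_map (coface ord_max) z)).
rewrite /= !rmorphD /= -!sr_comp !dconst_coface dconst_did !sr_id.
split; last by rewrite subrKC.
by rewrite addrCA -xy subrKC.
Qed.

Lemma pi0_map_to_pi0 (A B : scring) (f : scring_hom A B) m (a : A m) :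
  pi0_map f (to_pi0 A m a) = to_pi0 B m (f m a).
Proof.
rewrite [LHS](rliftE (@pi0_map_kernel A B f)) /=.
by rewrite srh_nat; apply: (to_pi0_nat (dconst 0 ord0)).
Qed.

Lemma tquot0_pi_eq0 (X : trng) (x : deg0 X) :
  tquot0_pi X x = 0 <-> (x : X 0) \in tideal X 0.
Proof.
rewrite -(rmorph0 (tquot0_pi X)); split.
  by move=> /(@gpiP X (tideal X) 0); rewrite subr0.
by move=> xt; apply/(@gpiP X (tideal X) 0); rewrite subr0.
Qed.

(** Vertex 0 of b and the image of a lift of a have the same class in pi_0 B, so they are joined by
    a path in B'. Since phi is constant along paths and A-linear, its value is forced. *)
Lemma cmap_const_scalar (A B : scring) (f : scring_hom A B) (B' : calg A)
    (q : calg_hom B' (CAlg f)) (C : galg (pi0 A))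
    (phi : cmap B' (tquot0_alg (const_salg C)) 0%N)
    m (s : dmap m 0) (b : B' m) (a : pi0 A) :
  is_weq (smap_of_scring_hom q) -> pi0_map f a = to_pi0 B m (q m b) ->
  cm_fun phi s b = tquot0_pi C (ga_str C a).
Proof.
move=> [q_inj _ _ _] ab; set a0 := rrepr a : A 0%N.
have aE : a = to_pi0 A 0 a0 by rewrite /= dconst_did sr_id rreprK.
have phiE l n (t : dmap l n) (r : dmap n 0) (r' : dmap l 0) x :
    cm_fun phi r' (sr_map t x) = cm_fun phi r x.
  have -> : r' = dcomp r t by apply: dmap_ext => j; rewrite ord1 [RHS]ord1.
  by rewrite cm_nat [LHS]tquot0_const_map.
have [w [w0 w1]] : @path0 (sset_of_scring B') (sr_map (dconst 0 ord0) b) (ca_str B' 0%N a0).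
  apply: q_inj; apply: path0_of_to_pi0; rewrite [smap_of_scring_hom _ _ _]/=.
  by rewrite srh_nat to_pi0_nat -ab aE pi0_map_to_pi0 [smap_of_scring_hom _ _ _]/= (cah_str q).
rewrite -(phiE _ _ (dconst 0 ord0) s (did 0)) -w0 (phiE _ _ _ (dconst 1 ord0)).
by rewrite -(phiE _ _ (coface ord_max) (dconst 1 ord0) (did 0)) [sr_map _ _]w1 cm_str aE.
Qed.

Theorem proposition6p12p1 (A B : scring) (f : scring_hom A B)
    (hf : forall y : pi0 B, exists x : pi0 A, pi0_map f x = y)
    (B' : calg A) (q : calg_hom B' (CAlg f))
    (hB' : calg_cofibrant B') (hq : is_weq (smap_of_scring_hom q))
    (R : salg A) (u : calg_hom B' (tquot0_alg R)) (hR : is_extended_rees u)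
    (S : galg (pi0 A)) (eta : galg_hom (gpi0 R) S)
    (hS : is_regularization eta) :
  exists alpha : galg_hom S (cl_rees (kernel (pi0_map f))),
    [/\ is_alpha q u eta alpha,
        forall alpha' : galg_hom S (cl_rees (kernel (pi0_map f))),
          is_alpha q u eta alpha' -> forall n x, alpha' n x = alpha n x
      & forall n, bijective (alpha n)].
Proof.
set T := cl_rees _; have T_regular : t_regular T := @cl_rees_regular _ _.
have [S_regular S_univ] := hS.
have scalarE (C : galg (pi0 A)) (g : galg_hom (gpi0 R) C) m (b : B' m) a :
    pi0_map f a = to_pi0 B m (q m b) ->
    tquot0_map (pi0_adj g m) (u m b) = tquot0_pi C (ga_str C a).
  exact: (cmap_const_scalar (univ u _ _ (gmap_of_hom g)) (dconst m ord0) hq).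
have gpi0_hom_unique (C : galg (pi0 A)) (g g' : galg_hom (gpi0 R) C) :
    t_regular C -> forall n x, g n x = g' n x.
  move=> C_regular; apply: (gpi0_hom_ext hR C_regular) => m b.
  by have [a ab] := hf (to_pi0 B m (q m b)); rewrite !(scalarE _ _ _ _ _ ab).
have kerT a : pi0_map f a = 0 -> (tquot0_pi T \o ga_str T) a = 0.
  by move=> fa0; apply/tquot0_pi_eq0/cl_rees_ideal/mk_zmodClosedP.
pose psi := surj_factor hf kerT.
(* The composite B' -> B -> pi_0 B -> (T/(t^-1))_0; the last map exists because I dies in the
   target. *)
have phi : cmap B' (tquot0_alg (const_salg T)) 0%N.
  refine (@CMapOb A B' (tquot0_alg (const_salg T)) 0
    (fun m _ => psi \o to_pi0 B m \o q m) _ _).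
  - move=> l m t s x; rewrite [RHS]tquot0_const_map [LHS]/= srh_nat.
    by congr (psi _); apply: to_pi0_nat.
  - move=> m s a; have aE := surj_factorE hf kerT (to_pi0 A m a).
    by rewrite [LHS]/= (cah_str q) [RHS]/= -[RHS]aE pi0_map_to_pi0.
have [g _] := gpi0_hom_ex hR T_regular phi.
have [[alpha alphaE] _] := S_univ T T_regular g.
have S_ideal a : a \in idl (kernel (pi0_map f)) -> ga_str S a \in tideal S 0.
  move=> /mk_zmodClosedP fa0; apply/tquot0_pi_eq0.
  (* An a in I lifts the class of b = 0, so [scalarE] identifies the class of a in S/(t^-1) with the
     image of u(0) = 0. *)
  have a0 : pi0_map f a = to_pi0 B 0 (q 0%N 0) by rewrite fa0 !rmorph0.
  by rewrite -(scalarE _ eta _ _ _ a0) !rmorph0.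
exists alpha; split.
- by move=> m b a ab; apply: scalarE.
- move=> alpha' _; have [_ ext] := S_univ T T_regular g.
  by apply: ext => // n x; apply: (gpi0_hom_unique _ (galg_comp alpha' eta)).
pose beta := rees_lift S_regular S_ideal.
move=> n; exists (beta n); last exact: rees_liftK.
pose S_id : galg_hom S S := @GAlgHom _ S S (thom_id S) (fun=> erefl).
have [_ ext] := S_univ S S_regular eta.
(* After [eta], both beta alpha and the identity become maps from pi_0 R to the regular S, and these
   are unique. *)
move=> x; apply: (ext (galg_comp beta alpha) S_id) => // m y.
exact: (gpi0_hom_unique S (galg_comp (galg_comp beta alpha) eta) eta S_regular).
Qed.
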